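(* Let $\kappa_1,\kappa_2\in\mathbb{R}$. If $L_1$ satisfies $CD_\Upsilon(\kappa_1,\infty)$ and $L_2$ satisfies $CD_\Upsilon(\kappa_2,\infty)$, then $L_1\oplus L_2$ satisfies $CD_\Upsilon(\kappa,\infty)$ with $\kappa=\min\{\kappa_1,\kappa_2\}$.
   Context: Setting (for a generic chain). $X$ is a finite or countably infinite set and $k:X\times X\to\mathbb{R}$ are transition rates: $k(x,y)\ge 0$ for $x\neq y$ and $k(x,x)=-\sum_{y\neq x}k(x,y)<0$. The generator is $Lf(x)=\sum_{y\in X}k(x,y)(f(y)-f(x))$. Standing assumptions: the chain is irreducible (for all $x,y\in X$ there are $x=z_1,\dots,z_m=y$, $m\ge2$, with $k(z_i,z_{i+1})>0$); it has an invariant measure $\mu$, unique up to positive multiples, with density $\pi:X\to(0,\infty)$ with respect to counting measure; detailed balance $\pi(x)k(x,y)=\pi(y)k(y,x)$ holds; and for every $x\in X$, $\sum_{y\neq x}k(x,y)<\infty$ and $\sum_{y\neq x}k(x,y)\sum_{z\neq y}k(y,z)<\infty$. Curvature condition. With $\Upsilon(r)=e^r-1-r$, set $\Psi_\Upsilon(f)(x)=\sum_{y}k(x,y)\Upsilon(f(y)-f(x))$, $B_{\Upsilon'}(f,g)(x)=\sum_y k(x,y)\Upsilon'(f(y)-f(x))(g(y)-g(x))$, $\Psi_{2,\Upsilon}(f)=\frac12\big(L\Psi_\Upsilon(f)-B_{\Upsilon'}(f,Lf)\big)$. $L$ satisfies $CD_\Upsilon(\kappa,\infty)$ if $\Psi_{2,\Upsilon}(f)(x)\ge\kappa\Psi_\Upsilon(f)(x)$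 for all $x\in X$ and all bounded $f:X\to\mathbb{R}$. Product. For $i=1,2$, $X_i$ is a finite or countably infinite set, $k_i:X_i\times X_i\to\mathbb{R}$ are transition rates with $k_i(x,y)\ge0$ for $x\neq y$ and $k_i(x,x)=-\sum_{y\neq x}k_i(x,y)<0$, and $L_i$ is the generator $L_if(x)=\sum_{y\in X_i}k_i(x,y)(f(y)-f(x))$ of the corresponding Markov chain on $X_i$; each of these two chains is irreducible, has an invariant measure $\mu_i$, unique up to positive multiples, with density $\pi_i:X_i\to(0,\infty)$ with respect to counting measure, satisfies detailed balance $\pi_i(x)k_i(x,y)=\pi_i(y)k_i(y,x)$, and satisfies $\sum_{y\neq x}k_i(x,y)<\infty$ and $\sum_{y\neq x}k_i(x,y)\sum_{z\neq y}k_i(y,z)<\infty$ for every $x\in X_i$. The operator $L_1\oplus L_2$ acts on functions $f:X_1\times X_2\to\mathbb{R}$ by $(L_1\oplus L_2)f(x,y)=L_1(f_y)(x)+L_2(f^x)(y)$, where $f_y=f(\cdot,y)$ and $f^x=f(x,\cdot)$. It is the generator of the Markov chain on $X_1\times X_2$ whose transition rates between distinct points are $k_\oplus((x_1,y_1),(x_2,y_2))=k_1(x_1,x_2)$ if $y_1=y_2$, $=k_2(y_1,y_2)$ if $x_1=x_2$, and $=0$ otherwise; $CD_\Upsilon$ for $L_1\oplus L_2$ is understood with respect to $k_\oplus$. *)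

(* Defs.v *)
From mathcomp Require Import all_boot all_order all_algebra.
From mathcomp Require Import all_classical all_reals all_analysis.
Import Order.TTheory GRing.Theory Num.Theory.
Import numFieldNormedType.Exports.

Set Implicit Arguments.
Unset Strict Implicit.
Unset Printing Implicit Defensive.

Local Open Scope classical_set_scope.
Local Open Scope ring_scope.

(* Unordered sum of a real family, as the sum of the positive parts minus the
   sum of the negative parts. It is the usual sum as soon as the family is
   absolutely summable; otherwise its value has no meaning. All the sums below
   converge absolutely for bounded f under the assumptions of [markov_rates]. *)
Definition csum (R : realType) (X : choiceType) (a : X -> R) : R :=
  fine (\esum_(x in [set: X]) ((EFin \o a)^\+ x)
        - \esum_(x in [set: X]) ((EFin \o a)^\- x))%E.

Definition generator (R : realType) (X : choiceType) (k : X -> X -> R)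
    (f : X -> R) (x : X) : R :=
  csum (fun y => k x y * (f y - f x)).

(* [nu] is the density, with respect to counting measure, of an invariant
   measure: it is nonnegative, not identically zero and, for every y,
   \sum_x nu x * k x y = 0, where the term x = y is moved to the right. On a
   countable discrete space a measure that is finite on points amounts to its
   density. *)
Definition invariant_density (R : realType) (X : choiceType)
    (k : X -> X -> R) (nu : X -> R) : Prop :=
  [/\ forall x, 0 <= nu x,
      exists x, nu x != 0 &
      forall y, (\esum_(x in [set~ y]) (nu x * k x y)%:E
                 = (nu y * - k y y)%:E)%E].

Record markov_rates (R : realType) (X : countType)
    (k : X -> X -> R) (pi : X -> R) : Prop := MarkovRates {
  rate_ge0 : forall x y, x != y -> 0 <= k x y ;
  rate_diag : forall x,
    ((k x x)%:E = - \esum_(y in [set~ x]) (k x y)%:E)%E ;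
  rate_diag_lt0 : forall x, k x x < 0 ;
  rate_irreducible : forall x y, exists p : seq X,
    [/\ p != [::], path (fun u v => 0 < k u v) x p & last x p = y] ;
  density_gt0 : forall x, 0 < pi x ;
  density_invariant : invariant_density k pi ;
  density_unique : forall nu : X -> R, invariant_density k nu ->
    exists2 c : R, 0 < c & forall x, nu x = c * pi x ;
  detailed_balance : forall x y, pi x * k x y = pi y * k y x ;
  rate_summable : forall x, (\esum_(y in [set~ x]) (k x y)%:E < +oo)%E ;
  rate_summable2 : forall x,
    (\esum_(y in [set~ x])
       ((k x y)%:E * \esum_(z in [set~ y]) (k y z)%:E) < +oo)%E }.

Definition Upsilon (R : realType) (r : R) : R := expR r - 1 - r.

Lemma derive1_Upsilon (R : realType) (r : R) : derive1 (@Upsilon R) r = expR r - 1.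
Proof.
rewrite derive1E.
have -> : @Upsilon R = (expR \- cst 1 \- id) by [].
by rewrite !deriveB// derive_val derive_cst derive_id subr0.
Qed.

Definition Psi (R : realType) (X : choiceType) (H : R -> R)
    (k : X -> X -> R) (f : X -> R) (x : X) : R :=
  csum (fun y => k x y * H (f y - f x)).

Definition Bop (R : realType) (X : choiceType) (H : R -> R)
    (k : X -> X -> R) (f g : X -> R) (x : X) : R :=
  csum (fun y => k x y * H (f y - f x) * (g y - g x)).

(* The operator L and the rates k are separate arguments because a product
   chain is given by an operator L1 (+) L2 together with its rates. *)
Definition Psi2_Upsilon (R : realType) (X : choiceType) (k : X -> X -> R)
    (L : (X -> R) -> X -> R) (f : X -> R) (x : X) : R :=
  2^-1 * (L (Psi (@Upsilon R) k f) x - Bop (derive1 (@Upsilon R)) k f (L f) x).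

Definition CD_Upsilon (R : realType) (X : choiceType) (k : X -> X -> R)
    (L : (X -> R) -> X -> R) (kappa : R) : Prop :=
  forall f : X -> R, bounded_fun f ->
    forall x, kappa * Psi (@Upsilon R) k f x <= Psi2_Upsilon k L f x.

Definition oplus (R : realType) (X1 X2 : choiceType)
    (L1 : (X1 -> R) -> X1 -> R) (L2 : (X2 -> R) -> X2 -> R)
    (f : X1 * X2 -> R) (u : X1 * X2) : R :=
  L1 (fun x => f (x, u.2)) u.1 + L2 (fun y => f (u.1, y)) u.2.

Definition rates_oplus_offdiag (R : realType) (X1 X2 : choiceType)
    (k1 : X1 -> X1 -> R) (k2 : X2 -> X2 -> R) (u v : X1 * X2) : R :=
  if u.2 == v.2 then k1 u.1 v.1
  else if u.1 == v.1 then k2 u.2 v.2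
  else 0.

Definition rates_oplus (R : realType) (X1 X2 : choiceType)
    (k1 : X1 -> X1 -> R) (k2 : X2 -> X2 -> R) (u v : X1 * X2) : R :=
  if u == v
  then - fine (\esum_(w in [set~ u]) (rates_oplus_offdiag k1 k2 u w)%:E)%E
  else rates_oplus_offdiag k1 k2 u v.

Lemma esum_cross (R : realType) (X1 X2 : choiceType) (u : X1 * X2)
  (g : X1 * X2 -> \bar R) : (forall w, 0 <= g w)%E ->
  (forall w, w.1 != u.1 -> w.2 != u.2 -> g w = 0)%E -> (g u = 0)%E ->
  (\esum_(w in [set: X1 * X2]) g w
   = \esum_(x in [set: X1]) g (x, u.2) + \esum_(y in [set: X2]) g (u.1, y))%E.
Proof.
case: u => u1 u2 /= g0 goff gu.
have H1 : set_inj [set: X1] (fun x : X1 => (x, u2)) by move=> x y _ _ [].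
have H2 : set_inj [set: X2] (fun y : X2 => (u1, y)) by move=> x y _ _ [].
rewrite -(esum_image _ _ g H1) -(esum_image _ _ g H2).
rewrite esum_mkcond [X in (_ + X)%E]esum_mkcond -esumD; last 2 first.
- by move=> i _; case: ifP.
- by move=> i _; case: ifP.
apply: eq_esum => -[x y] _.
have E1 : ((x, y) \in range (fun x : X1 => (x, u2))) = (y == u2).
  apply/idP/idP; first by rewrite inE => -[z _ [_ ->]].
  by move/eqP => ->; rewrite inE; exists x.
have E2 : ((x, y) \in range (fun y : X2 => (u1, y))) = (x == u1).
  apply/idP/idP; first by rewrite inE => -[z _ [->]].
  by move/eqP => ->; rewrite inE; exists y.
rewrite E1 E2.
have [->|yu] := eqVneq y u2; have [->|xu] := eqVneq x u1;
 by rewrite ?gu ?adde0 ?add0e// goff.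
Qed.

Lemma oplus_generator (R : realType) (X1 X2 : choiceType)
  (k1 : X1 -> X1 -> R) (k2 : X2 -> X2 -> R) (f : X1 * X2 -> R) u :
  summable setT (fun x => (k1 u.1 x * (f (x, u.2) - f u))%:E) ->
  summable setT (fun y => (k2 u.2 y * (f (u.1, y) - f u))%:E) ->
  oplus (generator k1) (generator k2) f u = generator (rates_oplus k1 k2) f u.
Proof.
move=> s1 s2.
pose a w := rates_oplus k1 k2 u w * (f w - f u).
have a1 x : a (x, u.2) = k1 u.1 x * (f (x, u.2) - f u).
  rewrite /a /rates_oplus; case: eqP => [<-|_]; first by rewrite subrr !mulr0.
  by rewrite /rates_oplus_offdiag /= eqxx.
have a2 y : a (u.1, y) = k2 u.2 y * (f (u.1, y) - f u).
  rewrite /a /rates_oplus; case: eqP => [<-|]; first by rewrite subrr !mulr0.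
  rewrite /rates_oplus_offdiag /= eqxx; case: eqP => // <-.
  by rewrite -surjective_pairing.
have aoff w : w.1 != u.1 -> w.2 != u.2 -> a w = 0.
  move=> w1 w2; rewrite /a /rates_oplus /rates_oplus_offdiag.
  case: (u =P w) => [uw|_]; first by rewrite uw eqxx in w1.
  by rewrite ![u.1 == _]eq_sym ![u.2 == _]eq_sym (negbTE w1) (negbTE w2) mul0r.
have au : a u = 0 by rewrite /a subrr mulr0.
rewrite /oplus /generator /csum -surjective_pairing.
rewrite (@esum_cross _ _ _ u ((EFin \o a)^\+%E)); first last.
- by rewrite funeposE /= au maxxx.
- by move=> w w1 w2; rewrite funeposE /= aoff// maxxx.
- by move=> w; exact: funepos_ge0.
rewrite (@esum_cross _ _ _ u ((EFin \o a)^\-%E)); first last.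
- by rewrite funenegE /= au oppr0 maxxx.
- by move=> w w1 w2; rewrite funenegE /= aoff// oppr0 maxxx.
- by move=> w; exact: funeneg_ge0.
pose b1 x := k1 u.1 x * (f (x, u.2) - f u).
pose b2 y := k2 u.2 y * (f (u.1, y) - f u).
have P1 : (\esum_(x in setT) (EFin \o a)^\+ (x, u.2) = \esum_(x in setT) (EFin \o b1)^\+ x)%E.
  by apply: eq_esum => x _; rewrite !funeposE /= a1.
have P2 : (\esum_(x in setT) (EFin \o a)^\+ (u.1, x) = \esum_(x in setT) (EFin \o b2)^\+ x)%E.
  by apply: eq_esum => x _; rewrite !funeposE /= a2.
have N1 : (\esum_(x in setT) (EFin \o a)^\- (x, u.2) = \esum_(x in setT) (EFin \o b1)^\- x)%E.
  by apply: eq_esum => x _; rewrite !funenegE /= a1.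
have N2 : (\esum_(x in setT) (EFin \o a)^\- (u.1, x) = \esum_(x in setT) (EFin \o b2)^\- x)%E.
  by apply: eq_esum => x _; rewrite !funenegE /= a2.
rewrite P1 P2 N1 N2.
have F (T : choiceType) (h : T -> \bar R) : (forall x, 0 <= h x)%E -> summable setT h ->
   (\esum_(x in setT) h x)%E \is a fin_num.
  move=> h0; rewrite summableE; congr (_ \is a fin_num).
  by apply: eq_esum => x _; rewrite gee0_abs.
have p1 := F _ _ (@funepos_ge0 _ _ _) (summable_funepos s1).
have p2 := F _ _ (@funepos_ge0 _ _ _) (summable_funepos s2).
have n1 := F _ _ (@funeneg_ge0 _ _ _) (summable_funeneg s1).
have n2 := F _ _ (@funeneg_ge0 _ _ _) (summable_funeneg s2).
rewrite /b1 /b2.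
rewrite -fineD ?fin_numB ?p1 ?p2 ?n1 ?n2//; congr fine.
rewrite fin_num_oppeD//.
by rewrite addeACA.
Qed.

(* Main.v *)
(* Write [P = Psi_1 + Psi_2] and [L = L_1 + L_2] on the product. In
   [L P - B(f, L f)] the terms pairing a factor with itself give the two
   one-factor quantities of the fibres through the base point. The remaining
   terms are sums over [(x', y')] with weights [k1 x x' * k2 y y'] of mixed
   differences of f over the rectangle x, x', y, y'; adding the two families,
   which takes an exchange of summations, leaves two Bregman remainders of
   [Upsilon], nonnegative by convexity. Everything converges absolutely since f
   is bounded and the rates are summable along paths of length at most two. *)
Require Import Defs.
From mathcomp Require Import all_boot all_order all_algebra.
From mathcomp Require Import all_classical all_reals all_analysis.
From mathcomp Require Import ring lra.
Import Order.TTheory GRing.Theory Num.Theory.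

Set Implicit Arguments.
Unset Strict Implicit.
Unset Printing Implicit Defensive.

Local Open Scope ring_scope.

(** * Absolutely summable families and the linearity of [csum] *)

Definition csummable {R : realType} {X : choiceType} (a : X -> R) : Prop :=
  summable setT (EFin \o a).

Lemma csummable_dom (R : realType) (X : choiceType) (a g : X -> R) :
  csummable g -> (forall x, `|a x| <= g x) -> csummable a.
Proof.
move=> sg ag; apply: le_lt_trans sg; apply: le_esum => x _ /=.
by rewrite lee_fin (le_trans (ag x)) ?ler_norm.
Qed.

Lemma csummable_norm (R : realType) (X : choiceType) (a : X -> R) :
  csummable a -> csummable (fun x => `|a x|).
Proof.
move=> sa; apply: le_lt_trans sa; apply: le_esum => x _ /=.
by rewrite lee_fin normr_id.
Qed.

Lemma csummableD (R : realType) (X : choiceType) (a b : X -> R) :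
  csummable a -> csummable b -> csummable (fun x => a x + b x).
Proof. exact: summableD. Qed.

Lemma csummableN (R : realType) (X : choiceType) (a : X -> R) :
  csummable a -> csummable (fun x => - a x).
Proof. by rewrite /csummable summableN. Qed.

Lemma csummableB (R : realType) (X : choiceType) (a b : X -> R) :
  csummable a -> csummable b -> csummable (fun x => a x - b x).
Proof. by move=> sa sb; apply: csummableD sa (csummableN sb). Qed.

(** A nonnegative scalar commutes with the supremum of finite partial sums, which is nonempty
    because of the empty sum; the value [+oo] is allowed. *)
Lemma esumZl (R : realType) (X : choiceType) (c : R) (a : X -> \bar R) :
  0 <= c -> (forall x, 0 <= a x)%E ->
  (\esum_(x in [set: X]) (c%:E * a x) = c%:E * \esum_(x in [set: X]) a x)%E.
Proof.
move=> c0 a0; rewrite /esum -ereal_supZl//; last first.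
  by apply/set0P; exists 0%E; exists set0; [exact: fsets_set0|rewrite fsbig_set0].
congr ereal_sup; apply/seteqP; split => y /=.
  move=> [A fA <-]; exists (\sum_(x \in A) a x)%E; first by exists A.
  by rewrite ge0_mule_fsumr.
by move=> [_ [A fA <-] <-]; exists A => //; rewrite ge0_mule_fsumr.
Qed.

Lemma csummableZ (R : realType) (X : choiceType) (c : R) (a : X -> R) :
  csummable a -> csummable (fun x => c * a x).
Proof.
move=> sa; rewrite /csummable /summable /=.
under eq_esum do rewrite normrM EFinM.
rewrite esumZl// lte_mul_pinfty ?lee_fin//.
Qed.

Lemma eq_csum (R : realType) (X : choiceType) (a b : X -> R) :
  (forall x, a x = b x) -> csum a = csum b.
Proof. by move=> /funext ->. Qed.

Lemma csum_ge0E (R : realType) (X : choiceType) (a : X -> R) :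
  (forall x, 0 <= a x) -> csum a = fine (\esum_(x in [set: X]) (a x)%:E).
Proof.
move=> a0; rewrite /csum [X in (_ - X)%E]esum1; last first.
  by move=> x _; rewrite funenegE /=; apply/max_idPr; rewrite lee_fin oppr_le0.
rewrite sube0; congr fine; apply: eq_esum => x _.
by rewrite funeposE /=; apply/max_idPl; rewrite lee_fin.
Qed.

Lemma csum_ge0 (R : realType) (X : choiceType) (a : X -> R) :
  (forall x, 0 <= a x) -> 0 <= csum a.
Proof.
move=> a0; rewrite csum_ge0E//; apply: fine_ge0; apply: esum_ge0 => x _.
by rewrite lee_fin.
Qed.

Lemma csum0 (R : realType) (X : choiceType) : csum (fun _ : X => 0 : R) = 0.
Proof. by rewrite csum_ge0E// esum1. Qed.

Lemma esum_ge0_fin_num (R : realType) (X : choiceType) (a : X -> \bar R) :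
  (forall x, 0 <= a x)%E -> summable setT a ->
  (\esum_(x in [set: X]) a x)%E \is a fin_num.
Proof.
move=> a0; rewrite summableE; congr (_ \is a fin_num).
by apply: eq_esum => x _; rewrite gee0_abs.
Qed.

Lemma csum_ge0_EFin (R : realType) (X : choiceType) (a : X -> R) :
  csummable a -> (forall x, 0 <= a x) ->
  ((csum a)%:E = \esum_(x in [set: X]) (a x)%:E)%E.
Proof. move=> sa a0; rewrite csum_ge0E// fineK//.
by apply: esum_ge0_fin_num sa => x; rewrite lee_fin. Qed.

Lemma csum_ge0D (R : realType) (X : choiceType) (a b : X -> R) :
  csummable a -> csummable b ->
  (forall x, 0 <= a x) -> (forall x, 0 <= b x) ->
  csum (fun x => a x + b x) = csum a + csum b.
Proof.
move=> sa sb a0 b0; apply: EFin_inj.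
rewrite EFinD !csum_ge0_EFin//; first last.
- by move=> x; rewrite addr_ge0.
- exact: csummableD.
by rewrite -esumD// => x _; rewrite lee_fin.
Qed.

Lemma csum_ge0B (R : realType) (X : choiceType) (a b : X -> R) :
  csummable a -> csummable b ->
  (forall x, 0 <= a x) -> (forall x, 0 <= b x) ->
  csum (fun x => a x - b x) = csum a - csum b.
Proof.
move=> sa sb a0 b0; apply: EFin_inj.
have sab := csummableB sa sb.
rewrite EFinB (csum_ge0_EFin sa a0) (csum_ge0_EFin sb b0) /csum fineK; last first.
  by rewrite fin_numB (esum_ge0_fin_num _ (summable_funepos sab)) ?(esum_ge0_fin_num _ (summable_funeneg sab))//.
by apply: (esumB sa sb) => x _; rewrite lee_fin.
Qed.

(** Reduces signed sums to nonnegative ones: [a + g] and [g] are both nonnegative, so identities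
    known for nonnegative families transfer to dominated ones. *)
Lemma csum_majorant (R : realType) (X : choiceType) (a g : X -> R) :
  csummable g -> (forall x, `|a x| <= g x) ->
  csum a = csum (fun x => a x + g x) - csum g.
Proof.
move=> sg ag; have sa := csummable_dom sg ag.
rewrite -csum_ge0B//.
- by apply: eq_csum => x; rewrite addrK.
- exact: csummableD.
- by move=> x; have := ag x; rewrite ler_norml => /andP[? ?]; lra.
- by move=> x; apply: le_trans (ag x).
Qed.

Lemma csumD (R : realType) (X : choiceType) (a b : X -> R) :
  csummable a -> csummable b ->
  csum (fun x => a x + b x) = csum a + csum b.
Proof.
move=> sa sb; have [na nb] := (csummable_norm sa, csummable_norm sb).
have sab := csummableD na nb.
have ge0 (c : X -> R) x : 0 <= c x + `|c x|.
  by have := lerNnormlW (lexx `|c x|); lra.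
(* The majorant of [a + b] is chosen as the sum of the majorants of [a] and [b], so the corrections
   cancel. *)
rewrite (@csum_majorant _ _ a _ na)// (@csum_majorant _ _ b _ nb)//.
rewrite (@csum_majorant _ _ (fun x => a x + b x) _ sab) => [|x]; last exact: ler_normD.
rewrite (csum_ge0D na nb)//.
rewrite (@eq_csum _ _ _ (fun x => (a x + `|a x|) + (b x + `|b x|))); last first.
  by move=> x; ring.
rewrite csum_ge0D; [by ring|exact: csummableD|exact: csummableD|exact: ge0..].
Qed.

Lemma csumN (R : realType) (X : choiceType) (a : X -> R) :
  csummable a -> csum (fun x => - a x) = - csum a.
Proof.
move=> sa; apply/eqP; rewrite -addr_eq0 -csumD//; last exact: csummableN.
by rewrite (@eq_csum _ _ _ (fun=> 0)) ?csum0// => x; rewrite addNr.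
Qed.

Lemma csumB (R : realType) (X : choiceType) (a b : X -> R) :
  csummable a -> csummable b ->
  csum (fun x => a x - b x) = csum a - csum b.
Proof. by move=> sa sb; rewrite csumD ?csumN//; exact: csummableN. Qed.

Lemma le_csum (R : realType) (X : choiceType) (a b : X -> R) :
  csummable a -> csummable b -> (forall x, a x <= b x) -> csum a <= csum b.
Proof.
by move=> sa sb ab; rewrite -subr_ge0 -csumB// csum_ge0// => x; rewrite subr_ge0.
Qed.

Lemma ler_norm_csum (R : realType) (X : choiceType) (a g : X -> R) :
  csummable g -> (forall x, `|a x| <= g x) -> `|csum a| <= csum g.
Proof.
move=> sg ag; have sa := csummable_dom sg ag.
rewrite ler_norml -csumN//.
by apply/andP; split; apply: le_csum => //; [exact: csummableN|..] => x;
   have := ag x; rewrite ler_norml => /andP[].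
Qed.

Lemma csumZ (R : realType) (X : choiceType) (c : R) (a : X -> R) :
  csummable a -> csum (fun x => c * a x) = c * csum a.
Proof.
wlog c0 : c / 0 <= c => [H|] sa.
  have [/H->//|c0] := leP 0 c.
  (* For negative [c] the nonnegative case is applied to [- c]. *)
  rewrite -[RHS]opprK -mulNr -H ?oppr_ge0 1?ltW// -csumN; last exact: csummableZ.
  by apply: eq_csum => x; ring.
have na := csummable_norm sa.
have Z (b : X -> R) : csummable b -> (forall x, 0 <= b x) ->
    csum (fun x => c * b x) = c * csum b.
  move=> sb b0; apply: EFin_inj; rewrite EFinM !csum_ge0_EFin//.
  - by rewrite -esumZl// => x; rewrite lee_fin.
  - exact: csummableZ.
  - by move=> x; rewrite mulr_ge0.
rewrite (@csum_majorant _ _ a _ na)// mulrBr -!Z//.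
- rewrite (@csum_majorant _ _ _ (fun x => c * `|a x|)); first by congr (_ - _); apply: eq_csum => x; ring.
  + exact: csummableZ.
  + by move=> x; rewrite normrM (ger0_norm c0).
- exact: csummableD.
- by move=> x; have := lerNnormlW (lexx `|a x|); lra.
Qed.

(** * Sums over product sets and exchange of summations *)

Lemma csum_cross (R : realType) (X1 X2 : choiceType) (u : X1 * X2)
    (a : X1 * X2 -> R) :
  (forall w, w.1 != u.1 -> w.2 != u.2 -> a w = 0) -> a u = 0 ->
  csummable (fun x => a (x, u.2)) -> csummable (fun y => a (u.1, y)) ->
  csum a = csum (fun x => a (x, u.2)) + csum (fun y => a (u.1, y)).
Proof.
move=> aoff au s1 s2; rewrite /csum.
(* Positive and negative parts are split separately; [u] lies on both lines of the cross but
   contributes 0. *)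
rewrite (@esum_cross _ _ _ u ((EFin \o a)^\+%E)); first last.
- by rewrite funeposE /= au maxxx.
- by move=> w w1 w2; rewrite funeposE /= aoff// maxxx.
- by move=> w; exact: funepos_ge0.
rewrite (@esum_cross _ _ _ u ((EFin \o a)^\-%E)); first last.
- by rewrite funenegE /= au oppr0 maxxx.
- by move=> w w1 w2; rewrite funenegE /= aoff// oppr0 maxxx.
- by move=> w; exact: funeneg_ge0.
have p1 := esum_ge0_fin_num (@funepos_ge0 _ _ _) (summable_funepos s1).
have p2 := esum_ge0_fin_num (@funepos_ge0 _ _ _) (summable_funepos s2).
have n1 := esum_ge0_fin_num (@funeneg_ge0 _ _ _) (summable_funeneg s1).
have n2 := esum_ge0_fin_num (@funeneg_ge0 _ _ _) (summable_funeneg s2).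
(* All four sums are finite, so their differences may be regrouped. *)
rewrite -fineD ?fin_numB ?p1 ?p2 ?n1 ?n2//; congr fine.
rewrite addeACA -(fin_num_oppeD _ n2).
by congr ((_ + _) - (_ + _))%E; apply: eq_esum => x _;
   rewrite ?funeposE ?funenegE.
Qed.

(** Tonelli: both iterated sums equal the sum over the product, up to swapping coordinates. *)
Lemma esum_swap (R : realType) (X Y : choiceType) (a : X -> Y -> \bar R) :
  (forall x y, 0 <= a x y)%E ->
  (\esum_(x in [set: X]) \esum_(y in [set: Y]) a x y =
   \esum_(y in [set: Y]) \esum_(x in [set: X]) a x y)%E.
Proof.
move=> a0; rewrite !esum_esum//.
have tot (S T : choiceType) : ([set: S] `*`` (fun=> [set: T]) = [set: S * T])%classic.
  by apply/seteqP; split.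
rewrite !tot (@reindex_esum _ _ _ setT setT (fun z : Y * X => (z.2, z.1)))//.
split => //; first by move=> [? ?] [? ?] _ _ [-> ->].
by move=> [x y] _; exists (y, x).
Qed.

(* Absolute convergence allows [K] to be added to the family, which reduces
   the interchange to nonnegative terms. *)
Lemma csum_swap (R : realType) (X Y : choiceType) (p : X -> R) (q : Y -> R)
    (K : R) (F : X -> Y -> R) :
  csummable p -> csummable q -> (forall x, 0 <= p x) -> (forall y, 0 <= q y) ->
  (forall x y, `|F x y| <= K) ->
  csum (fun x => p x * csum (fun y => q y * F x y)) =
  csum (fun y => q y * csum (fun x => p x * F x y)).
Proof.
move=> sp sq p0 q0 FK.
(* The shift by [K] adds [K * csum r * csum s] to the iterated sum and makes every term nonnegative.
   The index types are generic so that both orders of summation are covered. *)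
have swE (S T : choiceType) (r : S -> R) (s : T -> R) (G : S -> T -> R) :
    csummable r -> csummable s -> (forall x, 0 <= r x) -> (forall y, 0 <= s y) ->
    (forall x y, `|G x y| <= K) ->
  ((csum (fun x => r x * csum (fun y => s y * G x y)) + K * csum r * csum s)%:E
   = \esum_(x in [set: S]) \esum_(y in [set: T])
      (r x * s y * (G x y + K))%:E)%E.
  move=> sr ss r0 s0 GK.
  have GK0 x y : 0 <= G x y + K.
    by have := GK x y; rewrite ler_norml => /andP[? _]; lra.
  have bK x y : `|s y * G x y| <= K * s y.
    by rewrite normrM (ger0_norm (s0 y)) mulrC ler_wpM2r.
  have sKs := csummableZ K ss.
  have sG x : csummable (fun y => s y * G x y).
    exact: csummable_dom sKs (bK x).
  have inner x : csum (fun y => s y * (G x y + K)) =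
      csum (fun y => s y * G x y) + K * csum s.
    rewrite -csumZ// -csumD//.
    by apply: eq_csum => y; ring.
  have sI : csummable (fun x => r x * csum (fun y => s y * G x y)).
    apply: csummable_dom (csummableZ (K * csum s) sr) _ => x.
    rewrite normrM (ger0_norm (r0 x)) mulrC ler_wpM2r//.
    by rewrite -csumZ//; exact: ler_norm_csum.
  have -> : csum (fun x => r x * csum (fun y => s y * G x y)) +
      K * csum r * csum s =
      csum (fun x => r x * csum (fun y => s y * (G x y + K))).
    rewrite (_ : K * csum r * csum s = (K * csum s) * csum r); last by ring.
    rewrite -csumZ// -csumD//; last exact: csummableZ.
    by apply: eq_csum => x; rewrite inner; ring.
  rewrite csum_ge0_EFin; first last.
  - by move=> x; rewrite mulr_ge0// csum_ge0// => y; rewrite mulr_ge0.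
  - apply: (eq_ind _ csummable (csummableD sI (csummableZ (K * csum s) sr))).
    by apply/funext => x; rewrite inner; ring.
  apply: eq_esum => x _; rewrite EFinM csum_ge0_EFin; first last.
  - by move=> y; rewrite mulr_ge0.
  - apply: (eq_ind _ csummable (csummableD (sG x) sKs)).
    by apply/funext => y; ring.
  rewrite -esumZl//; first by apply: eq_esum => y _; rewrite -EFinM mulrA.
  by move=> y; rewrite lee_fin mulr_ge0.
have := swE _ _ _ _ (fun y x => F x y) sq sp q0 p0 (fun y x => FK x y).
rewrite esum_swap => [|y x]; last first.
  by rewrite lee_fin !mulr_ge0//; have := FK x y; rewrite ler_norml => /andP[? _]; lra.
(* Both orders now give the same nonnegative double sum, and the added constant is the same on each
   side, so it cancels. *)
have := swE _ _ _ _ F sp sq p0 q0 FK.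
rewrite (eq_esum (b := fun x => \esum_(y in [set: Y])
    (q y * p x * (F x y + K))%:E)%E) => [<- []|x _]; first lra.
by apply: eq_esum => y _; congr (_%:E); ring.
Qed.

(** * Off-diagonal rates and summability against them *)

Definition offdiag {R : realType} {X : choiceType} (k : X -> X -> R) (x y : X) : R :=
  if x == y then 0 else k x y.

(** The integrands to come vanish at the base point, so the negative diagonal rate may be replaced
    by 0, which leaves nonnegative weights. *)
Lemma offdiag_mul (R : realType) (X : choiceType) (k : X -> X -> R) x (h : X -> R) :
  h x = 0 -> (fun y => k x y * h y) = (fun y => offdiag k x y * h y).
Proof.
move=> hx; apply/funext => y; rewrite /offdiag.
by case: eqP => [<-|//]; rewrite hx !mulr0.
Qed.

Lemma offdiag_ge0 (R : realType) (X : countType) (k : X -> X -> R) pi :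
  markov_rates k pi -> forall x y, 0 <= offdiag k x y.
Proof.
by move=> mk x y; rewrite /offdiag; case: ifPn => // /(rate_ge0 mk).
Qed.

(** The factor [a] lets one identity serve both summability assumptions: it is 1 for the first and
    the total exit rate for the second. *)
Lemma esum_offdiag (R : realType) (X : choiceType) (k : X -> X -> R) x
    (a : X -> \bar R) :
  (\esum_(y in [set~ x]) ((k x y)%:E * a y)
   = \esum_(y in [set: X]) ((offdiag k x y)%:E * a y))%E.
Proof.
rewrite esum_mkcond; apply: eq_esum => y _; rewrite /offdiag in_setC in_set1.
by rewrite eq_sym; case: eqP; rewrite ?mul0e.
Qed.

Lemma csummable_offdiag (R : realType) (X : countType) (k : X -> X -> R) pi :
  markov_rates k pi -> forall x, csummable (offdiag k x).
Proof.
move=> mk x; have := rate_summable mk x.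
rewrite (eq_esum (b := fun y => (k x y)%:E * 1)%E) => [|y _]; last by rewrite mule1.
rewrite esum_offdiag => h; apply: le_lt_trans h; apply: le_esum => y _ /=.
by rewrite mule1 ger0_norm ?(offdiag_ge0 mk).
Qed.

Lemma csummable_offdiag2 (R : realType) (X : countType) (k : X -> X -> R) pi :
  markov_rates k pi ->
  forall x, csummable (fun y => offdiag k x y * csum (offdiag k y)).
Proof.
move=> mk x; have := rate_summable2 mk x.
rewrite esum_offdiag => h; apply: le_lt_trans h; apply: le_esum => y _ /=.
have k0 := offdiag_ge0 mk.
rewrite ger0_norm; last by rewrite mulr_ge0// csum_ge0.
rewrite EFinM csum_ge0_EFin//; last exact: csummable_offdiag mk y.
rewrite [in leRHS](eq_esum (b := fun z => (k y z)%:E * 1)%E) => [|z _]; last by rewrite mule1.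
by rewrite esum_offdiag; under [in leRHS]eq_esum do rewrite mule1.
Qed.

(** For bounded functions, [Psi] and [generator] at [y] are controlled by a multiple of the exit
    rate [csum (offdiag k y)], which may be unbounded in [y]. The [K] term is summed by
    [rate_summable], the [M] term by [rate_summable2]. *)
Lemma csummable_rates (R : realType) (X : countType) (k : X -> X -> R) pi x
    (h : X -> R) (K M : R) :
  markov_rates k pi -> h x = 0 ->
  (forall y, `|h y| <= K + M * csum (offdiag k y)) ->
  csummable (fun y => k x y * h y).
Proof.
move=> mk hx hK; rewrite offdiag_mul//.
apply: (csummable_dom (csummableD (csummableZ K (csummable_offdiag mk x))
                        (csummableZ M (csummable_offdiag2 mk x)))) => y.
have k0 := offdiag_ge0 mk x y.
rewrite normrM (ger0_norm k0) mulrCA [K * _]mulrC -mulrDr.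
exact: ler_wpM2l.
Qed.

Lemma csummable_rates_bounded (R : realType) (X : countType) (k : X -> X -> R) pi x
    (h : X -> R) (K : R) :
  markov_rates k pi -> h x = 0 -> (forall y, `|h y| <= K) ->
  csummable (fun y => k x y * h y).
Proof.
move=> mk hx hK; apply: (@csummable_rates _ _ _ pi _ _ K 0) => // y.
by rewrite mul0r addr0.
Qed.

Lemma ler_norm_csum_rates (R : realType) (X : countType) (k : X -> X -> R) pi x
    (h : X -> R) (K : R) :
  markov_rates k pi -> h x = 0 -> (forall y, `|h y| <= K) ->
  `|csum (fun y => k x y * h y)| <= K * csum (offdiag k x).
Proof.
move=> mk hx hK; have sk := csummable_offdiag mk x.
rewrite offdiag_mul// -csumZ//; apply: ler_norm_csum; first exact: csummableZ.
move=> y; have k0 := offdiag_ge0 mk x y.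
by rewrite normrM mulrC (ger0_norm k0) ler_wpM2r.
Qed.

(** Since [h] vanishes at the base point, the diagonal value of [rates_oplus] drops out and the sum
    lives on the cross through that point. *)
Lemma csum_rates_oplus (R : realType) (X1 X2 : countType)
    (k1 : X1 -> X1 -> R) (k2 : X2 -> X2 -> R) x y (h : X1 * X2 -> R) :
  h (x, y) = 0 ->
  csummable (fun x' => k1 x x' * h (x', y)) ->
  csummable (fun y' => k2 y y' * h (x, y')) ->
  csum (fun w => rates_oplus k1 k2 (x, y) w * h w) =
  csum (fun x' => k1 x x' * h (x', y)) + csum (fun y' => k2 y y' * h (x, y')).
Proof.
move=> h0 s1 s2; pose a w := rates_oplus k1 k2 (x, y) w * h w.
have a1 : (fun x' => a (x', y)) = (fun x' => k1 x x' * h (x', y)).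
  apply/funext => x'; rewrite /a /rates_oplus; case: eqP => [[<-]|_].
    by rewrite h0 !mulr0.
  by rewrite /rates_oplus_offdiag /= eqxx.
have a2 : (fun y' => a (x, y')) = (fun y' => k2 y y' * h (x, y')).
  apply/funext => y'; rewrite /a /rates_oplus; case: eqP => [[<-]|].
    by rewrite h0 !mulr0.
  by rewrite /rates_oplus_offdiag /= eqxx; case: (y =P y') => // ->.
rewrite -/a (@csum_cross _ _ _ (x, y)) /= ?a1 ?a2//; last by rewrite /a h0 mulr0.
move=> [x' y'] /= xx' yy'; rewrite /a /rates_oplus /rates_oplus_offdiag /=.
case: eqP => [[E _]|_]; first by rewrite E eqxx in xx'.
by rewrite ![_ == x']eq_sym ![_ == y']eq_sym (negbTE xx') (negbTE yy') mul0r.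
Qed.

(** * Mixed second differences and the splitting of [L P - B(f, L f)] *)

Lemma csum_mixed_ge0 (R : realType) (X Y : choiceType) (p : X -> R) (q : Y -> R)
    (K : R) (F : X -> Y -> R) (G : Y -> X -> R) :
  csummable p -> csummable q -> (forall x, 0 <= p x) -> (forall y, 0 <= q y) ->
  (forall x y, `|F x y| <= K) -> (forall y x, `|G y x| <= K) ->
  (forall x y, 0 <= F x y + G y x) ->
  0 <= csum (fun x => p x * csum (fun y => q y * F x y)) +
       csum (fun y => q y * csum (fun x => p x * G y x)).
Proof.
move=> sp sq p0 q0 FK GK FG0.
have sF (S : X -> Y -> R) : (forall x y, `|S x y| <= K) ->
    forall x, csummable (fun y => q y * S x y).
  move=> SK x; apply: csummable_dom (csummableZ K sq) _ => y.
  by rewrite normrM mulrC (ger0_norm (q0 y)) ler_wpM2r.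
have ssF (S : X -> Y -> R) : (forall x y, `|S x y| <= K) ->
    csummable (fun x => p x * csum (fun y => q y * S x y)).
  move=> SK; apply: csummable_dom (csummableZ (K * csum q) sp) _ => x.
  rewrite normrM mulrC (ger0_norm (p0 x)) ler_wpM2r// -csumZ//.
  apply: ler_norm_csum (csummableZ K sq) _ => y.
  by rewrite normrM mulrC (ger0_norm (q0 y)) ler_wpM2r.
(* After exchanging the sums of [G], both double sums carry the weights [p x * q y] in the same
   order and combine termwise into [F x y + G y x]. *)
rewrite (csum_swap sq sp q0 p0 GK) -csumD; first last.
- by apply: (ssF (fun x y => G y x)) => x y.
- exact: ssF.
apply: csum_ge0 => x; rewrite -mulrDr -csumD; first last.
- by apply: (sF (fun x y => G y x)) => x' y.
- exact: sF.
by rewrite mulr_ge0// csum_ge0// => y; rewrite -mulrDr mulr_ge0.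
Qed.

(* The mixed second difference produced by moving along [x -> x'] in one factor
   and along [y -> y'] in the other. *)
Definition mixed {R : realType} {X Y : Type} (H H' : R -> R) (g : X -> Y -> R)
    (x : X) (y : Y) (x' : X) (y' : Y) : R :=
  H (g x' y' - g x' y) - H (g x y' - g x y)
  - H' (g x' y - g x y) * ((g x' y' - g x' y) - (g x y' - g x y)).

(** The two values of [H] account for [K + K]; the last term bounds [H'] times a second difference
    made of four values of [g]. *)
Lemma ler_norm_mixed (R : realType) (X Y : Type) (H H' : R -> R)
    (g : X -> Y -> R) (M K : R) x y x' y' :
  (forall x y, `|g x y| <= M) ->
  (forall r, `|r| <= M + M -> `|H r| <= K /\ `|H' r| <= K) ->
  `|mixed H H' g x y x' y'| <= K + K + K * (M + M + (M + M)).
Proof.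
move=> gM HK.
have dM a b c d : `|g a b - g c d| <= M + M by rewrite (le_trans (ler_normB _ _))// lerD.
rewrite /mixed (le_trans (ler_normB _ _))// lerD//.
  by rewrite (le_trans (ler_normB _ _))// lerD//; apply: (HK _ _).1.
rewrite normrM ler_pM//; first exact: (HK _ _).2.
by rewrite (le_trans (ler_normB _ _))// lerD.
Qed.

(* Convexity: with [a = g x' y - g x y], [b = g x y' - g x y] and the second
   difference [d], the sum is the sum of the two Bregman remainders
   [H (a + d) - H a - H' a d] and [H (b + d) - H b - H' b d]. *)
Lemma mixed_ge0 (R : realType) (X Y : Type) (H H' : R -> R) (g : X -> Y -> R)
    x y x' y' :
  (forall r d, H r + H' r * d <= H (r + d)) ->
  0 <= mixed H H' g x y x' y' + mixed H H' (fun y x => g x y) y x y' x'.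
Proof.
move=> Hconv; rewrite /mixed.
set a := g x' y - g x y; set b := g x y' - g x y.
set d := g x' y' - g x' y - b.
have -> : g x' y' - g x' y = b + d by rewrite /d; ring.
have -> : g x' y' - g x y' = a + d by rewrite /d /a /b; ring.
have := Hconv a d; have := Hconv b d.
rewrite (_ : a + d - a = d); last by ring.
lra.
Qed.

(** Isolates the jumps of one factor. With [g] curried and [P], [G] given only on the fibre through
    [y], it applies to either factor after exchanging roles. The summability conclusion is what
    later splits [Bop] of the product. *)
Lemma generator_sub_Bop_oplus (R : realType) (X1 X2 : countType)
    (k1 : X1 -> X1 -> R) (k2 : X2 -> X2 -> R) pi1 pi2
    (H H' : R -> R) (g : X1 -> X2 -> R) (M K : R) x y
    (P G : X1 -> R) :
  markov_rates k1 pi1 -> markov_rates k2 pi2 ->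
  H 0 = 0 ->
  (forall x y, `|g x y| <= M) ->
  (forall r, `|r| <= M + M -> `|H r| <= K /\ `|H' r| <= K) ->
  (forall x', P x' = Psi H k1 (g^~ y) x' + Psi H k2 (g x') y) ->
  (forall x', G x' = generator k1 (g^~ y) x' + generator k2 (g x') y) ->
  csummable (fun x' => k1 x x' * (H' (g x' y - g x y) * (G x' - G x))) /\
  generator k1 P x
  - csum (fun x' => k1 x x' * (H' (g x' y - g x y) * (G x' - G x)))
  = generator k1 (Psi H k1 (g^~ y)) x
    - Bop H' k1 (g^~ y) (generator k1 (g^~ y)) x
    + csum (fun x' => offdiag k1 x x' *
        csum (fun y' => offdiag k2 y y' * mixed H H' g x y x' y')).
Proof.
move=> mk1 mk2 H0 gM HK PE GE.
have dM a b c d : `|g a b - g c d| <= M + M by rewrite (le_trans (ler_normB _ _))// lerD.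
have HM a b c d : `|H (g a b - g c d)| <= K by apply: (HK _ _).1.
have HM' a b c d : `|H' (g a b - g c d)| <= K by apply: (HK _ _).2.
have K0 : 0 <= K by apply: le_trans (HM x y x y).
pose p1 := Psi H k1 (g^~ y); pose p2 x' := Psi H k2 (g x') y.
pose g1 := generator k1 (g^~ y); pose g2 x' := generator k2 (g x') y.
have p1b x' : `|p1 x'| <= K * csum (offdiag k1 x').
  by apply: ler_norm_csum_rates mk1 _ _ => //; rewrite subrr.
have p2b x' : `|p2 x'| <= K * csum (offdiag k2 y).
  by apply: ler_norm_csum_rates mk2 _ _ => //; rewrite subrr.
have g1b x' : `|g1 x'| <= (M + M) * csum (offdiag k1 x').
  by apply: ler_norm_csum_rates mk1 _ _ => //; rewrite subrr.
have g2b x' : `|g2 x'| <= (M + M) * csum (offdiag k2 y).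
  by apply: ler_norm_csum_rates mk2 _ _ => //; rewrite subrr.
have sp1 : csummable (fun x' => k1 x x' * (p1 x' - p1 x)).
  apply: (@csummable_rates _ _ _ pi1 _ _ (K * csum (offdiag k1 x)) K) => // [|x'].
    by rewrite subrr.
  by rewrite (le_trans (ler_normB _ _))// addrC lerD.
have sp2 : csummable (fun x' => k1 x x' * (p2 x' - p2 x)).
  apply: (@csummable_rates_bounded _ _ _ pi1 _ _
    (K * csum (offdiag k2 y) + K * csum (offdiag k2 y))) => // [|x'].
    by rewrite subrr.
  by rewrite (le_trans (ler_normB _ _))// lerD.
have sg1 : csummable (fun x' => k1 x x' * (H' (g x' y - g x y) * (g1 x' - g1 x))).
  apply: (@csummable_rates _ _ _ pi1 _ _
    (K * ((M + M) * csum (offdiag k1 x))) (K * (M + M))) => // [|x'].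
    by rewrite !subrr mulr0.
  rewrite -mulrA -mulrDr normrM ler_pM//.
  by rewrite (le_trans (ler_normB _ _))// addrC lerD.
have sg2 : csummable (fun x' => k1 x x' * (H' (g x' y - g x y) * (g2 x' - g2 x))).
  apply: (@csummable_rates_bounded _ _ _ pi1 _ _ (K *
    ((M + M) * csum (offdiag k2 y) + (M + M) * csum (offdiag k2 y)))) => // [|x'].
    by rewrite !subrr mulr0.
  rewrite normrM ler_pM//.
  by rewrite (le_trans (ler_normB _ _))// lerD.
have BE : (fun x' => k1 x x' * (H' (g x' y - g x y) * (G x' - G x))) =
    (fun x' => k1 x x' * (H' (g x' y - g x y) * (g1 x' - g1 x)) +
               k1 x x' * (H' (g x' y - g x y) * (g2 x' - g2 x))).
  by apply/funext => x'; rewrite !GE -/(g1 x') -/(g1 x) -/(g2 x') -/(g2 x); ring.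
rewrite BE; split; first exact: csummableD.
have -> : generator k1 P x = csum (fun x' => k1 x x' * (p1 x' - p1 x)) +
    csum (fun x' => k1 x x' * (p2 x' - p2 x)).
  rewrite -csumD//; apply: eq_csum => x'.
  by rewrite !PE -/(p1 x') -/(p1 x) -/(p2 x') -/(p2 x); ring.
rewrite csumD//.
have -> : Bop H' k1 (g^~ y) (generator k1 (g^~ y)) x =
    csum (fun x' => k1 x x' * (H' (g x' y - g x y) * (g1 x' - g1 x))).
  by apply: eq_csum => x'; rewrite mulrA.
have inner x' : p2 x' - p2 x - H' (g x' y - g x y) * (g2 x' - g2 x) =
    csum (fun y' => offdiag k2 y y' * mixed H H' g x y x' y').
  have sk2 := csummable_offdiag mk2 y.
  have s2 (h : X2 -> R) : h y = 0 -> (exists B : R, forall y', `|h y'| <= B) ->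
      csummable (fun y' => offdiag k2 y y' * h y').
    move=> hy [B hB]; rewrite -offdiag_mul//.
    exact: (csummable_rates_bounded mk2 hy hB).
  have sH z : csummable (fun y' => offdiag k2 y y' * H (g z y' - g z y)).
    by apply: s2; [rewrite subrr|exists K].
  have sI z : csummable (fun y' => offdiag k2 y y' * (g z y' - g z y)).
    by apply: s2; [rewrite subrr|exists (M + M)].
  have p2E z : p2 z = csum (fun y' => offdiag k2 y y' * H (g z y' - g z y)).
    by rewrite -offdiag_mul// subrr.
  have g2E z : g2 z = csum (fun y' => offdiag k2 y y' * (g z y' - g z y)).
    by rewrite -offdiag_mul// subrr.
  rewrite !p2E !g2E -!csumB// -csumZ; last exact: csummableB.
  rewrite -csumB; [|exact: csummableB|by apply: csummableZ; exact: csummableB].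
  by apply: eq_csum => y'; rewrite /mixed; ring.
have <- : csum (fun x' => k1 x x' *
    (p2 x' - p2 x - H' (g x' y - g x y) * (g2 x' - g2 x))) =
    csum (fun x' => offdiag k1 x x' *
        csum (fun y' => offdiag k2 y y' * mixed H H' g x y x' y')).
  rewrite offdiag_mul; last by rewrite !subrr mulr0 subrr.
  by apply: eq_csum => x'; rewrite inner.
have -> : csum (fun x' => k1 x x' *
    (p2 x' - p2 x - H' (g x' y - g x y) * (g2 x' - g2 x))) =
  csum (fun x' => k1 x x' * (p2 x' - p2 x)) -
  csum (fun x' => k1 x x' * (H' (g x' y - g x y) * (g2 x' - g2 x))).
  by rewrite -csumB//; apply: eq_csum => x'; rewrite mulrBr.
rewrite /generator -/p1; ring.
Qed.

(** * Convexity and bounds of [Upsilon] *)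

Lemma Upsilon_ge0 (R : realType) (r : R) : 0 <= Upsilon r.
Proof. by rewrite /Upsilon; have := expR_ge1Dx r; lra. Qed.

Lemma Upsilon0 (R : realType) : Upsilon (0 : R) = 0.
Proof. by rewrite /Upsilon expR0; ring. Qed.

(** The gap between the two sides is [expR r * (expR d - 1 - d)]. *)
Lemma Upsilon_convex (R : realType) (r d : R) :
  Upsilon r + derive1 (@Upsilon R) r * d <= Upsilon (r + d).
Proof.
rewrite derive1_Upsilon /Upsilon expRD.
have := expR_gt0 r; have := expR_ge1Dx d; nra.
Qed.

(** One constant serves both the function and its derivative, as the bounds on mixed differences
    require. *)
Lemma ler_norm_Upsilon (R : realType) (B r : R) : `|r| <= B ->
  `|Upsilon r| <= expR B + 1 + B /\
  `|derive1 (@Upsilon R) r| <= expR B + 1 + B.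
Proof.
move=> rB; have := expR_gt0 r.
have : expR r <= expR B by rewrite ler_expR (le_trans (ler_norm r)).
have B0 : 0 <= B by apply: le_trans rB.
move: rB; rewrite derive1_Upsilon /Upsilon !ler_norml => /andP[? ?] ? ?.
by split; apply/andP; split; lra.
Qed.

(** * The curvature bound for the product chain *)

Lemma Psi_oplus (R : realType) (X1 X2 : countType)
    (k1 : X1 -> X1 -> R) (k2 : X2 -> X2 -> R) pi1 pi2
    (H : R -> R) (f : X1 * X2 -> R) (K : R) x y :
  markov_rates k1 pi1 -> markov_rates k2 pi2 -> H 0 = 0 ->
  (forall u v, `|H (f u - f v)| <= K) ->
  Psi H (rates_oplus k1 k2) f (x, y) =
  Psi H k1 (fun x => f (x, y)) x + Psi H k2 (fun y => f (x, y)) y.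
Proof.
move=> mk1 mk2 H0 HK.
apply: (@csum_rates_oplus _ _ _ k1 k2 x y (fun w => H (f w - f (x, y)))).
- by rewrite subrr.
- apply: csummable_rates_bounded mk1 _ (fun x' => HK (x', y) (x, y)).
  by rewrite subrr.
- apply: csummable_rates_bounded mk2 _ (fun y' => HK (x, y') (x, y)).
  by rewrite subrr.
Qed.

(** The point [t] makes the filter [globally setT] proper, as [ex_bound] asks. *)
Lemma bounded_fun_exP (R : realType) (T : Type) (f : T -> R) (t : T) :
  bounded_fun f <-> exists M : R, forall x, `|f x| <= M.
Proof.
apply: iff_trans (@ex_bound _ _ _ f _ (@globally_properfilter _ setT t I)) _.
by split=> -[M fM]; exists M => x; [exact: fM|move=> _; exact: fM].
Qed.

Unset Implicit Arguments.

Theorem theorem4p2 (R : realType) (X1 X2 : countType)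
    (k1 : X1 -> X1 -> R) (k2 : X2 -> X2 -> R)
    (pi1 : X1 -> R) (pi2 : X2 -> R) (kappa1 kappa2 : R)
    (chain1 : markov_rates k1 pi1) (chain2 : markov_rates k2 pi2)
    (CD1 : CD_Upsilon k1 (generator k1) kappa1)
    (CD2 : CD_Upsilon k2 (generator k2) kappa2) :
  CD_Upsilon (rates_oplus k1 k2) (oplus (generator k1) (generator k2))
    (Num.min kappa1 kappa2).
Proof.
move=> f bf [x y].
have [M fM] := (bounded_fun_exP f (x, y)).1 bf.
have bf1 : bounded_fun (fun x' => f (x', y)) by apply/(bounded_fun_exP _ x); exists M.
have bf2 : bounded_fun (fun y' => f (x, y')) by apply/(bounded_fun_exP _ y); exists M.
have := CD2 _ bf2 y; have := CD1 _ bf1 x.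
have UM r : `|r| <= M + M -> _ := @ler_norm_Upsilon R (M + M) r.
set K := expR (M + M) + 1 + (M + M) in UM.
have fUM u v : `|Upsilon (f u - f v)| <= K.
  by apply: (UM _ _).1; rewrite (le_trans (ler_normB _ _))// lerD.
have PE x' y' := Psi_oplus x' y' chain1 chain2 (Upsilon0 R) fUM.
rewrite /Psi2_Upsilon PE.
set P := Psi _ (rates_oplus k1 k2) f in PE *.
set U' := derive1 (@Upsilon R) in UM *.
pose G := oplus (generator k1) (generator k2) f.
have [s1 E1] := @generator_sub_Bop_oplus R X1 X2 k1 k2 pi1 pi2 (@Upsilon R) U'
  (fun x y => f (x, y)) M K x y (fun x' => P (x', y)) (fun x' => G (x', y))
  chain1 chain2 (Upsilon0 R) (fun x y => fM (x, y)) UM (PE^~ y) (fun=> erefl).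
(* Same splitting with the factors exchanged; [addrC] reorders the two summands of [P] and [G]
   accordingly. *)
have [s2 E2] := @generator_sub_Bop_oplus R X2 X1 k2 k1 pi2 pi1 (@Upsilon R) U'
  (fun y x => f (x, y)) M K y x (fun y' => P (x, y')) (fun y' => G (x, y'))
  chain2 chain1 (Upsilon0 R) (fun y x => fM (x, y)) UM
  (fun y' => etrans (PE x y') (addrC _ _)) (fun=> addrC _ _).
have BE : Bop U' (rates_oplus k1 k2) f G (x, y) =
    csum (fun x' => k1 x x' * (U' (f (x', y) - f (x, y)) * (G (x', y) - G (x, y)))) +
    csum (fun y' => k2 y y' * (U' (f (x, y') - f (x, y)) * (G (x, y') - G (x, y)))).
  rewrite -(@csum_rates_oplus _ _ _ k1 k2 x y
    (fun w => U' (f w - f (x, y)) * (G w - G (x, y))))//.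
    by apply: eq_csum => w; rewrite mulrA.
  by rewrite /= !subrr mulr0.
(* The mixed sums of [E1] and [E2] run over the same rectangles in opposite orders; their total is
   nonnegative by convexity. *)
have mix := @csum_mixed_ge0 R X1 X2 (offdiag k1 x) (offdiag k2 y) _
  (mixed (@Upsilon R) U' (fun x y => f (x, y)) x y)
  (mixed (@Upsilon R) U' (fun y x => f (x, y)) y x)
  (csummable_offdiag chain1 x) (csummable_offdiag chain2 y)
  (offdiag_ge0 chain1 x) (offdiag_ge0 chain2 y)
  (fun x' y' => ler_norm_mixed x y x' y' (fun x y => fM (x, y)) UM)
  (fun y' x' => ler_norm_mixed y x y' x' (fun y x => fM (x, y)) UM)
  (fun x' y' => mixed_ge0 (fun x y => f (x, y)) x y x' y' (@Upsilon_convex R)).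
rewrite -/G BE /oplus /=.
(* Nonnegativity of [Psi] on each fibre allows each [kappa] to be lowered to the minimum. *)
have psi_ge0 (X : countType) (k : X -> X -> R) pi h z : markov_rates k pi ->
    0 <= Psi (@Upsilon R) k h z.
  move=> mk; rewrite /Psi offdiag_mul; last by rewrite subrr Upsilon0.
  by apply: csum_ge0 => w; rewrite mulr_ge0 ?Upsilon_ge0 ?(offdiag_ge0 mk).
have := psi_ge0 _ _ _ (fun x' => f (x', y)) x chain1.
have := psi_ge0 _ _ _ (fun y' => f (x, y')) y chain2.
set p1 := Psi _ k1 _ x; set p2 := Psi _ k2 _ y => p20 p10 cd1 cd2.
have m1 : Num.min kappa1 kappa2 * p1 <= kappa1 * p1.
  by rewrite ler_wpM2r// ge_min lexx.
have m2 : Num.min kappa1 kappa2 * p2 <= kappa2 * p2.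
  by rewrite ler_wpM2r// ge_min lexx orbT.
(* Half the sum of [E1] and [E2], with the mixed part dropped by [mix], dominates the two one-factor
   bounds [cd1] and [cd2]. *)
rewrite mulrDr; lra.
Qed.
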